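(* Let $(\mathbf{u},\boldsymbol{\gamma})\in\mathbb{R}^{3n}\times\,]0,1[^{n-1}$ be such that $(1-\gamma_j)_{1\le j\le n-1}$ and $(u_j)_{1\le j\le n}$ are sufficiently small. Then an asymptotic expansion of $\lambda_n^{\pm}(\mathbf{u},\boldsymbol{\gamma})$ is $$\lambda_n^{\pm}(\mathbf{u},\boldsymbol{\gamma})=\bar u\pm\left[\sqrt{H}-\frac{1}{2H^{3/2}}\sum_{j=1}^{n-1}(1-\gamma_j)\Big(\sum_{k=1}^jh_k\Big)\Big(\sum_{k=j+1}^nh_k\Big)\right]+\mathcal{O}\Big(\big((1-\gamma_j)^2\big)_{j},\big((1-\gamma_j)u_k\big)_{j,k},\big(u_k^2\big)_{k}\Big),$$ where $j$ ranges over $\{1,\dots,n-1\}$ and $k$ over $\{1,\dots,n\}$ in the error term.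
   Context: $\mathbf{u}={}^{\top}(h_1,\dots,h_n,u_1,\dots,u_n,v_1,\dots,v_n)$ with $h_j>0$ (fixed in the expansion), $H=\sum_{i=1}^nh_i$, $\bar u=\frac1H\sum_{i=1}^nh_iu_i$. $\alpha_{i,k}=\prod_{j=k}^{i-1}\gamma_j$ if $k<i$, $\alpha_{i,k}=1$ if $k\ge i$; $\mathsf{V}_x=\mathrm{diag}(u_j)$, $\mathsf{H}=\mathrm{diag}(h_j)$, $\mathsf{\Gamma}=[\alpha_{i,k}]$; $$\mathsf{A}_x=\begin{pmatrix}\mathsf{V}_x&\mathsf{H}&0\\ \mathsf{\Gamma}&\mathsf{V}_x&0\\0&0&\mathsf{V}_x\end{pmatrix}.$$ $\lambda_n^\pm(\mathbf{u},\boldsymbol{\gamma})$ (the barotropic eigenvalues) are the eigenvalues of $\mathsf{A}_x(\mathbf{u},\boldsymbol{\gamma})$ that reduce to the simple eigenvalues $\pm\sqrt H$ when all $u_j=0$ and all $\gamma_j=1$. $\mathcal{O}$ of a family of quantities denotes a term bounded by a constant times the sum of their absolute values. *)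

(* Defs.v *)
From mathcomp Require Import all_boot all_order all_algebra.
From mathcomp Require Import reals exp.

Set Implicit Arguments.
Unset Strict Implicit.
Unset Printing Implicit Defensive.

Import Order.TTheory GRing.Theory Num.Theory.
Local Open Scope ring_scope.

Section MultiLayer.
Variables (R : realType) (n : nat).

(* The full state is the column (h_1..h_n, u_1..u_n, v_1..v_n).  Layers are
   numbered from 0, and entry j : 'I_n.-1 of gamma is the ratio attached to the
   interface between layers j and j+1. *)
Implicit Types (U : 'cV[R]_(n + n + n)) (gamma : 'cV[R]_n.-1).

Definition thickness U : 'cV[R]_n := usubmx (usubmx U).
Definition velocity_x U : 'cV[R]_n := dsubmx (usubmx U).

Definition total_height (h : 'cV[R]_n) : R := \sum_i h i 0.

Definition mean_velocity_x U : R :=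
  (\sum_i thickness U i 0 * velocity_x U i 0) / total_height (thickness U).

Definition alpha gamma (i k : 'I_n) : R :=
  if (k < i)%N then \prod_(j < n.-1 | (k <= j < i)%N) gamma j 0 else 1.

Definition Gamma_mx gamma : 'M[R]_n := \matrix_(i, k) alpha gamma i k.

Definition A_x U gamma : 'M[R]_(n + n + n) :=
  let V := diag_mx (velocity_x U)^T in
  let Hm := diag_mx (thickness U)^T in
  block_mx (block_mx V Hm (Gamma_mx gamma) V) 0 0 V.

(* (U, gamma) has thicknesses h and is delta-close to rest (u = 0, gamma = 1);
   the transverse velocities v are unconstrained.  The value gamma_j = 1 is
   admitted so that the reference configuration itself belongs to the domain. *)
Definition near_rest (h : 'cV[R]_n) (delta : R) U gamma : Prop :=
  [/\ thickness U = h,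
      forall k, `|velocity_x U k 0| < delta &
      forall j, 0 < gamma j 0 <= 1 /\ 1 - gamma j 0 < delta].

(* lam is a branch lambda_n^+ (s = false) or lambda_n^- (s = true) for the
   thicknesses h: an eigenvalue of A_x near rest, equal to +-sqrt H at rest and
   continuous there.  The continuity is uniform in v, since A_x does not involve
   v.  As +-sqrt H is a simple eigenvalue at rest, two such branches agree close
   enough to rest. *)
Definition barotropic_eigenvalue (h : 'cV[R]_n) (s : bool)
    (lam : 'cV[R]_(n + n + n) -> 'cV[R]_n.-1 -> R) : Prop :=
  let lam0 := (-1) ^+ s * Num.sqrt (total_height h) in
  [/\ exists2 delta : R, 0 < delta &
        forall U gamma, near_rest h delta U gamma ->
          eigenvalue (A_x U gamma) (lam U gamma),
      forall U, thickness U = h -> velocity_x U = 0 ->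
        lam U (const_mx 1) = lam0 &
      forall e : R, 0 < e -> exists2 delta : R, 0 < delta &
        forall U gamma, near_rest h delta U gamma ->
          `|lam U gamma - lam0| < e].

Definition barotropic_expansion (s : bool) U gamma : R :=
  let h := thickness U in
  let H := total_height h in
  mean_velocity_x U + (-1) ^+ s *
    (Num.sqrt H - (2 * H `^ (3 / 2))^-1 *
       \sum_(j < n.-1) (1 - gamma j 0) * (\sum_(k < n | (k <= j)%N) h k 0)
                                       * (\sum_(k < n | (j < k)%N) h k 0)).

Definition remainder_scale U gamma : R :=
  let u := velocity_x U in
  \sum_(j < n.-1) `|(1 - gamma j 0) ^+ 2|
  + \sum_(j < n.-1) \sum_(k < n) `|(1 - gamma j 0) * u k 0|
  + \sum_(k < n) `|u k 0 ^+ 2|.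

End MultiLayer.

(* Main.v *)
Require Import Defs.
From mathcomp Require Import all_boot all_order perm all_algebra.
From mathcomp Require Import reals exp boolp ring lra.

(** Away from the velocities u_j, the first two blocks of a row eigenvector
(p, q, r) determine each other and r vanishes, so x is an eigenvalue of A_x
exactly when some q <> 0 satisfies
  sum_i q_i alpha_ij h_j = (x - u_j)^2 q_j   for all j
([eigenvalue_A_xP]).  At rest, for x <> 0, this says that q is proportional to h and
that x^2 = H.

Write e for the sum of all 1 - gamma_j and |u_k|.  Near rest, with x close to
+-sqrt H, a solution q has a nonzero sum, and once that sum is normalised to 1
one finds q = h/H + O(e) ([mode_close_to_thickness]).  Adding the n equations
gives a relation that is exact:
  x^2 - 2 x sum_j q_j u_j + sum_j q_j u_j^2
    = H - sum_ij q_i h_j (1 - alpha_ij).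
Here q is always multiplied by a small factor, so replacing q by h/H costs only
O(e^2), and so does replacing 1 - alpha_ij by the sum of the 1 - gamma_l over
the interfaces l between the layers j and i.  Thus
  (x - ubar)^2 = H - B/H + O(e^2),
where B = sum_ij h_i h_j sum_l (1 - gamma_l) becomes, on summing over l last,
the double product of the theorem ([sum_interface_defect]).  The right side is
the square of sqrt H - B/(2 H^(3/2)) up to O(e^2); factoring the difference of
squares, one factor of which is at least sqrt H in absolute value, gives the
expansion ([eigenmode_expansion]).  Finally e^2 is at most a multiple of the
stated remainder ([defects_sqr_le]).

This estimate holds for every eigenvalue in a fixed window around +-sqrt H, so
it also yields continuity at rest of any choice of such an eigenvalue.  The
existence of a branch is thereby reduced to finding one eigenvalue in that
window, which the intermediate value theorem provides: the determinant of the
secular equation is a polynomial in x, it changes sign across +-sqrt H at rest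
by an explicit rank-one computation, and the sign at two fixed points survives
small perturbations of the entries ([secular_root]). *)

Set Implicit Arguments.
Unset Strict Implicit.
Unset Printing Implicit Defensive.

Import Order.TTheory GRing.Theory Num.Theory.
Local Open Scope ring_scope.

(** * Reduction of the eigenvalue problem to one equation per layer *)

(** The middle block of the eigenvector equation reads
p_j h_j = (x - u_j) q_j and the first one sum_i q_i alpha_ij = (x - u_j) p_j;
multiplying the latter by h_j eliminates p. *)
Lemma eigenvalue_A_xP (R : realType) (n : nat) (U : 'cV[R]_(n + n + n))
    (gamma : 'cV[R]_n.-1) (x : R) :
  (forall j, x - velocity_x U j 0 != 0) ->
  eigenvalue (A_x U gamma) x <->
  exists2 q : 'rV[R]_n, q != 0 &
    forall j, \sum_i q 0 i * alpha gamma i j * thickness U j 0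
              = (x - velocity_x U j 0) ^+ 2 * q 0 j.
Proof.
move=> xu; set u := velocity_x U in xu *; set h := thickness U.
have actE (p q r : 'rV[R]_n) :
    row_mx (row_mx p q) r *m A_x U gamma
    = row_mx (row_mx (p *m diag_mx u^T + q *m Gamma_mx gamma)
                     (p *m diag_mx h^T + q *m diag_mx u^T))
             (r *m diag_mx u^T).
  by rewrite /A_x !mul_row_block !mulmx0 addr0 add0r.
clearbody u h.
split.
  case/eigenvalueP => w; rewrite -(hsubmxK w) -(hsubmxK (lsubmx w)).
  move: (lsubmx (lsubmx w)) (rsubmx (lsubmx w)) (rsubmx w) => p q r {w}.
  rewrite actE !scale_row_mx => /eq_row_mx[/eq_row_mx[pE qE] rE] w0.
  have r0 : r = 0.
    apply/rowP => j; move/rowP: rE => /(_ j); rewrite mul_mx_diag !mxE => rE.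
    have /eqP : (x - u j 0) * r 0 j = 0 by rewrite mulrBl -rE; ring.
    by rewrite mulf_eq0 (negPf (xu j)) => /eqP ->.
  have pqE j : p 0 j * h j 0 = (x - u j 0) * q 0 j.
    by move/rowP: qE => /(_ j); rewrite !mul_mx_diag !mxE => qE; lra.
  have qpE j : \sum_i q 0 i * alpha gamma i j = (x - u j 0) * p 0 j.
    move/rowP: pE => /(_ j); rewrite mul_mx_diag !mxE => pE.
    rewrite mulrBl -pE [p 0 j * _]mulrC addrAC subrr add0r.
    by apply: eq_bigr => i _; rewrite mxE.
  (* If q vanished, the first block would force p = 0 as well. *)
  exists q => [|j].
    apply: contraNneq w0 => q0; rewrite r0 q0.
    suff -> : p = 0 by rewrite !row_mx0.
    apply/rowP => j; rewrite mxE; have /esym/eqP := qpE j.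
    rewrite big1 => [|i _]; last by rewrite q0 mxE mul0r.
    by rewrite mulf_eq0 (negPf (xu j)) => /eqP.
  by rewrite -mulr_suml qpE -mulrA pqE; ring.
case=> q q0 qE.
pose p : 'rV[R]_n := \row_j ((\sum_i q 0 i * alpha gamma i j) / (x - u j 0)).
apply/eigenvalueP; exists (row_mx (row_mx p q) 0); last first.
  apply: contraNneq q0 => w0.
  have : row_mx (row_mx p q) 0 = row_mx (row_mx 0 0) 0 :> 'rV[R]_(n + n + n).
    by rewrite w0 !row_mx0.
  by case/eq_row_mx => /eq_row_mx[_ ->].
rewrite actE !scale_row_mx mul0mx scaler0; congr (row_mx (row_mx _ _) _).
  apply/rowP => j; rewrite mul_mx_diag !mxE.
  under [X in _ + X]eq_bigr => i _ do rewrite mxE.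
  by field; apply: xu.
apply/rowP => j; rewrite !mul_mx_diag !mxE.
have := qE j; rewrite -mulr_suml => qEj.
by rewrite mulrAC qEj; field; apply: xu.
Qed.

(** * Elementary inequalities and determinants *)

(** A product of factors close to 1 is, to first order, 1 minus the sum of the
deficits; adjoining a factor with deficit t changes the second-order error by
t times the previous deficit. *)
Lemma prod_deficit (R : realDomainType) (I : Type) (r : seq I) (P : pred I)
    (g : I -> R) :
  (forall i, 0 < g i <= 1) ->
  let s := \sum_(i <- r | P i) (1 - g i) in
  let d := 1 - \prod_(i <- r | P i) g i in
  [/\ 0 <= d, d <= s & s - d <= s ^+ 2].
Proof.
move=> g01 /=; elim: r => [|i r [d_ge0 d_le sd_le]].
  by rewrite !big_nil; split; lra.
rewrite !big_cons; case: (P i) => //.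
move: d_ge0 d_le sd_le; have := g01 i.
set s := \sum_(_ <- _ | _) _; set p := \prod_(_ <- _ | _) _.
by move=> /andP[g0 g1] d_ge0 d_le sd_le; split; nra.
Qed.

(** The Cauchy-Schwarz inequality against the constant vector 1. *)
Lemma sqr_sum_le (R : realFieldType) (n : nat) (a : 'I_n -> R) :
  (\sum_i a i) ^+ 2 <= n%:R * \sum_i a i ^+ 2.
Proof.
have -> : n%:R * \sum_i a i ^+ 2
    = \sum_i \sum_j (a i ^+ 2 + a j ^+ 2) / 2.
  transitivity (\sum_(i < n) (n%:R * a i ^+ 2 + \sum_j a j ^+ 2) / 2).
    rewrite -mulr_suml big_split /= -mulr_sumr sumr_const card_ord.
    by rewrite -mulr_natl; field.
  apply: eq_bigr => i _; rewrite -mulr_suml big_split /= sumr_const card_ord.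
  by rewrite mulr_natl.
rewrite expr2 mulr_suml; apply: ler_sum => i _; rewrite mulr_sumr.
by apply: ler_sum => j _; have := sqr_ge0 (a i - a j); lra.
Qed.

(** Both sides are the determinant of the block matrix with rows (1, r) and
(c, a), computed by eliminating either diagonal block. *)
Lemma det_scalar_sub_rank1 (R : fieldType) (n : nat) (a : R)
    (c : 'cV[R]_n) (r : 'rV[R]_n) :
  a != 0 -> \det (a%:M - c *m r) = a ^+ n * (1 - (r *m c) 0 0 / a).
Proof.
move=> a0; set W : 'M_(1 + n) := block_mx 1%:M r c a%:M.
have W1 : W = block_mx 1%:M 0 c 1%:M *m block_mx 1%:M r 0 (a%:M - c *m r).
  rewrite mulmx_block !(mul1mx, mulmx1, mul0mx, addr0).
  by rewrite addrC subrK.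
have W2 : W = block_mx (1%:M - a^-1 *: (r *m c)) (a^-1 *: r) 0 1%:M
              *m block_mx 1%:M 0 c a%:M.
  rewrite mulmx_block !(mul1mx, mulmx1, mul0mx, mulmx0, add0r).
  by rewrite -scalemxAl subrK mul_mx_scalar scalerA divff // scale1r.
have := congr1 determinant W1; rewrite W2 !det_mulmx.
rewrite det_lblock det_ublock det_lblock det_ublock !det1 !mul1r mulr1.
rewrite det_scalar det_mx11 !mxE mulr1n => <-.
by rewrite mulrC [a^-1 * _]mulrC.
Qed.

(** Telescoping; the factors 1 + |b_i| bound |a_i| as well, because d <= 1. *)
Lemma prod_sub_le (R : realDomainType) (I : Type) (r : seq I) (a b : I -> R)
    (d : R) :
  0 <= d <= 1 -> (forall i, `|a i - b i| <= d) ->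
  `|\prod_(i <- r) a i - \prod_(i <- r) b i|
    <= d * \prod_(i <- r) (1 + `|b i|).
Proof.
move=> /andP[d0 d1] abd; elim: r => [|i r IH].
  by rewrite !big_nil subrr normr0 mulr1.
rewrite !big_cons; set A := \prod_(_ <- _) a _ in IH *.
set B := \prod_(_ <- _) b _ in IH *; set Q := \prod_(_ <- _) _ in IH *.
have AQ : `|A| <= Q.
  rewrite /A /Q normr_prod; apply: ler_prod => j _; rewrite normr_ge0 /=.
  by have := ler_normD (a j - b j) (b j); rewrite subrK; have := abd j; lra.
have -> : a i * A - b i * B = (a i - b i) * A + b i * (A - B) by ring.
apply: le_trans (ler_normD _ _) _; rewrite !normrM.
have -> : d * ((1 + `|b i|) * Q) = d * Q + `|b i| * (d * Q) by ring.
by apply: lerD; [apply: ler_pM | apply: ler_wpM2l].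
Qed.

(** A Lipschitz bound at B whose constant depends on B alone; where det B is
nonzero it gives a neighbourhood on which the determinant keeps its sign. *)
Lemma det_sub_le (R : realDomainType) (n : nat) (A B : 'M[R]_n) (d : R) :
  0 <= d <= 1 -> (forall i j, `|A i j - B i j| <= d) ->
  `|\det A - \det B|
    <= d * \sum_(s : 'S_n) \prod_i (1 + `|B i (s i)|).
Proof.
move=> d01 ABd; rewrite /determinant -sumrB mulr_sumr.
apply: le_trans (ler_norm_sum _ _ _) _; apply: ler_sum => s _.
rewrite -mulrBr normrM normrX normrN1 expr1n mul1r.
by apply: prod_sub_le => // i.
Qed.

(** * The expansion for an abstract eigenmode *)

Lemma norm_weighted_sum_le (R : realDomainType) (I : finType) (a b : I -> R)
    (M : R) :
  (forall i, `|b i| <= M) -> `|\sum_i a i * b i| <= (\sum_i `|a i|) * M.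
Proof.
move=> bM; apply: le_trans (ler_norm_sum _ _ _) _; rewrite mulr_suml.
by apply: ler_sum => i _; rewrite normrM ler_wpM2l.
Qed.

(** Throughout this part c stands for sqrt H, al for the matrix alpha, b for the
first-order part of 1 - alpha, and eta and v measure the distance of alpha from
1 and of u from 0.

If the entries of q cancelled in the sum, every equation would have a right
side small compared with the mass of q, whereas the left side is bounded below
because |x - u_j| >= c / 2.  This is what permits normalising the sum to 1. *)
Lemma eigenvector_mass (R : realFieldType) (n : nat) (h u q : 'I_n -> R)
    (al : 'I_n -> 'I_n -> R) (c x eta v : R) :
  0 < c -> (forall i, 0 < h i) -> \sum_i h i = c ^+ 2 ->
  3 / 4 * c <= `|x| -> (forall j, `|u j| <= v) -> v <= c / 4 ->
  eta <= 1 / 8 -> (forall i j, `|1 - al i j| <= eta) ->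
  (forall j, \sum_i q i * al i j * h j = (x - u j) ^+ 2 * q j) ->
  \sum_i `|q i| <= 8 * `|\sum_i q i|.
Proof.
move=> c0 h0 hc x_ge uv vc eta8 al1 qE.
set N := \sum_i `|q i|; set S := \sum_i q i.
have N0 : 0 <= N by apply: sumr_ge0.
have colE j : (x - u j) ^+ 2 * q j = (S - \sum_i q i * (1 - al i j)) * h j.
  rewrite -qE -sumrB mulr_suml; apply: eq_bigr => i _; ring.
have gap j : c ^+ 2 / 4 <= (x - u j) ^+ 2.
  have : c / 2 <= `|x - u j|.
    by have := lerB_dist x (u j); have := uv j; lra.
  by rewrite -[(x - _) ^+ 2]real_normK ?num_real //; nra.
have bnd j : c ^+ 2 / 4 * `|q j| <= (`|S| + N * eta) * h j.
  apply: (@le_trans _ _ `|(x - u j) ^+ 2 * q j|).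
    by rewrite normrM ger0_norm ?sqr_ge0 // ler_wpM2r.
  rewrite colE normrM (gtr0_norm (h0 j)) ler_wpM2r ?(ltW (h0 j)) //.
  apply: le_trans (ler_normB _ _) _; rewrite lerD2l.
  exact: norm_weighted_sum_le.
have : c ^+ 2 / 4 * N <= (`|S| + N * eta) * c ^+ 2.
  by rewrite -hc /N !mulr_sumr ler_sum // => j _; rewrite hc.
have c2 : 0 < c ^+ 2 by rewrite exprn_gt0.
rewrite [_ * c ^+ 2]mulrC -mulrA ler_pM2l // => H1.
nra.
Qed.

(** The constants here and below are those that the estimates happen to
produce; what matters is that they depend on c alone. *)
Definition mode_constant (R : realFieldType) (c : R) : R :=
  216 * c + 72 * c ^+ 2.

Definition secular_constant (R : realFieldType) (c : R) : R :=
  let K := mode_constant c in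
  5 / 2 * c * K + 9 * c ^+ 2 + K * c ^+ 2 + c ^+ 4.

Definition expansion_constant (R : realFieldType) (c : R) : R :=
  (secular_constant c + c ^+ 4) / c ^+ 3.

Lemma expansion_constant_ge0 (R : realFieldType) (c : R) :
  0 <= c -> 0 <= expansion_constant c.
Proof.
move=> c0; rewrite divr_ge0 ?exprn_ge0 // addr_ge0 ?exprn_ge0 //.
have K0 : 0 <= mode_constant c by rewrite addr_ge0 // !mulr_ge0.
by rewrite !addr_ge0 ?mulr_ge0 ?exprn_ge0 ?invr_ge0.
Qed.

(** First |x^2 q_j - h_j| is bounded directly from the equations; summing over j
gives |x^2 - c^2|, after which x^2 may be replaced by c^2. *)
Lemma mode_close_to_thickness (R : realFieldType) (n : nat)
    (h u q : 'I_n -> R) (al : 'I_n -> 'I_n -> R) (c x eta v : R) :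
  0 < c -> (forall i, 0 < h i) -> \sum_i h i = c ^+ 2 ->
  `|x| <= 5 / 4 * c -> (forall j, `|u j| <= v) -> 0 <= v <= c / 4 ->
  0 <= eta -> (forall i j, `|1 - al i j| <= eta) ->
  (forall j, \sum_i q i * al i j * h j = (x - u j) ^+ 2 * q j) ->
  \sum_i q i = 1 -> \sum_i `|q i| <= 8 ->
  \sum_j `|c ^+ 2 * q j - h j| <= mode_constant c * (eta + v).
Proof.
move=> c0 h0 hc x_le uv /andP[v0 vc] eta0 al1 qE q1 q8.
have c2 : 0 < c ^+ 2 by rewrite exprn_gt0.
pose z j := \sum_i q i * (1 - al i j).
have z_le j : `|z j| <= 8 * eta.
  apply: le_trans (@norm_weighted_sum_le _ _ _ _ eta _) _ => //.
  by rewrite ler_wpM2r.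
have colE j : (x - u j) ^+ 2 * q j = (1 - z j) * h j.
  rewrite -qE -q1 -sumrB mulr_suml; apply: eq_bigr => i _; ring.
pose a j := x ^+ 2 * q j - h j.
have aE j : a j = q j * (2 * x * u j - u j ^+ 2) - h j * z j.
  by have := colE j; rewrite /a; lra.
have w_le j : `|2 * x * u j - u j ^+ 2| <= 3 * c * v.
  apply: le_trans (ler_normB _ _) _; rewrite normrX !normrM normr_nat.
  have := uv j; have := normr_ge0 (u j); have := normr_ge0 x.
  set X := `|x| in x_le *; set Y := `|u j| => X0 Y0 Yv.
  have : X * Y <= 5 / 4 * c * v by rewrite ler_pM.
  have : Y ^+ 2 <= c / 4 * v by rewrite expr2 ler_pM //; lra.
  nra.
pose E := 24 * c * v + 8 * c ^+ 2 * eta.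
have a_le : \sum_j `|a j| <= E.
  apply: (@le_trans _ _ (\sum_j (`|q j| * (3 * c * v) + h j * (8 * eta)))).
    apply: ler_sum => j _; rewrite aE; apply: le_trans (ler_normB _ _) _.
    rewrite normrM [`|h j * _|]normrM (gtr0_norm (h0 j)).
    by apply: lerD; rewrite ler_wpM2l // ltW.
  rewrite big_split /= -!mulr_suml hc /E.
  have : (\sum_j `|q j|) * (3 * c * v) <= 8 * (3 * c * v).
    by rewrite ler_wpM2r // !mulr_ge0 // ltW.
  lra.
have xc : `|x ^+ 2 - c ^+ 2| <= E.
  have -> : x ^+ 2 - c ^+ 2 = \sum_j a j.
    by rewrite /a sumrB -mulr_sumr q1 hc mulr1.
  exact: le_trans (ler_norm_sum _ _ _) a_le.
have E0 : 0 <= E by rewrite /E addr_ge0 // !mulr_ge0 // ltW.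
have fE : \sum_j `|c ^+ 2 * q j - h j| <= E + 8 * E.
  apply: (@le_trans _ _ (\sum_j (`|a j| + `|q j| * E))).
    apply: ler_sum => j _.
    have -> : c ^+ 2 * q j - h j = a j - q j * (x ^+ 2 - c ^+ 2).
      by rewrite /a; ring.
    apply: le_trans (ler_normB _ _) _; rewrite lerD2l normrM.
    by rewrite ler_wpM2l.
  rewrite big_split /= -mulr_suml; apply: lerD => //.
  by rewrite ler_wpM2r.
apply: le_trans fE _; rewrite /mode_constant /E.
by have := mulr_ge0 (ltW c0) eta0; have := mulr_ge0 (ltW c2) v0; lra.
Qed.

(** The sum of all the equations, multiplied by c^2 = H and arranged so that q
appears on the right only in terms that are visibly of second order: f, the
deviation of H q from h, is small and is multiplied by u or 1 - alpha. *)
Lemma secular_identity (R : realFieldType) (n : nat)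
    (h u q : 'I_n -> R) (al b : 'I_n -> 'I_n -> R) (c x : R) :
  c != 0 -> \sum_i h i = c ^+ 2 -> \sum_i q i = 1 ->
  (forall j, \sum_i q i * al i j * h j = (x - u j) ^+ 2 * q j) ->
  let f j := c ^+ 2 * q j - h j in
  c ^+ 2 * (x - (\sum_j h j * u j) / c ^+ 2) ^+ 2
    - (c ^+ 4 - \sum_i \sum_j h i * h j * b i j)
  = 2 * x * (\sum_j f j * u j) - c ^+ 2 * (\sum_j q j * u j ^+ 2)
    + (\sum_j h j * (\sum_i h i * (b i j - (1 - al i j)))
       - \sum_j h j * (\sum_i f i * (1 - al i j)))
    + (\sum_j h j * u j) ^+ 2 / c ^+ 2.
Proof.
move=> c0 hc q1 qE f; set t3 := \sum_j h j * (\sum_i f i * _).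
set t4 := \sum_j h j * (\sum_i h i * _); set t2 := \sum_j q j * u j ^+ 2.
set ub := \sum_j h j * u j; set B := \sum_i \sum_j _.
pose z j := \sum_i q i * (1 - al i j).
have colE j : (x - u j) ^+ 2 * q j = h j - h j * z j.
  transitivity (h j * (\sum_i q i - z j)); last by rewrite q1; ring.
  rewrite -qE -sumrB mulr_sumr.
  by apply: eq_bigr => i _; ring.
have colsum : x ^+ 2 = c ^+ 2 - \sum_j h j * z j - t2
    + 2 * x * (\sum_j q j * u j).
  rewrite -hc -sumrB mulr_sumr -[x ^+ 2]mulr1 -{1}q1 mulr_sumr -sumrB.
  rewrite -big_split /=; apply: eq_bigr => j _.
  by rewrite -colE; ring.
have t1E : \sum_j f j * u j = c ^+ 2 * (\sum_j q j * u j) - ub.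
  by rewrite /ub mulr_sumr -sumrB; apply: eq_bigr => j _; rewrite /f; ring.
have tE : t4 - t3 = B - c ^+ 2 * \sum_j h j * z j.
  rewrite /B exchange_big /= mulr_sumr -!sumrB; apply: eq_bigr => j _.
  rewrite /z -mulrBr -sumrB !mulr_sumr -sumrB; apply: eq_bigr => i _.
  by rewrite /f; ring.
have -> : c ^+ 2 * (x - ub / c ^+ 2) ^+ 2
    = c ^+ 2 * x ^+ 2 - 2 * x * ub + ub ^+ 2 / c ^+ 2 by field.
by rewrite tE t1E {1}colsum; ring.
Qed.

Lemma normalised_secular_estimate (R : realFieldType) (n : nat)
    (h u q : 'I_n -> R) (al b : 'I_n -> 'I_n -> R) (c x eta v : R) :
  0 < c -> (forall i, 0 < h i) -> \sum_i h i = c ^+ 2 ->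
  `|x| <= 5 / 4 * c -> (forall j, `|u j| <= v) -> 0 <= v <= c / 4 ->
  0 <= eta -> (forall i j, `|1 - al i j| <= eta) ->
  (forall i j, `|b i j - (1 - al i j)| <= eta ^+ 2) ->
  (forall j, \sum_i q i * al i j * h j = (x - u j) ^+ 2 * q j) ->
  \sum_i q i = 1 -> \sum_i `|q i| <= 8 ->
  `|c ^+ 2 * (x - (\sum_j h j * u j) / c ^+ 2) ^+ 2
     - (c ^+ 4 - \sum_i \sum_j h i * h j * b i j)|
   <= secular_constant c * (eta + v) ^+ 2.
Proof.
move=> c0 h0 hc x_le uv v_bnd eta0 al1 bal qE q1 q8.
have f_le := mode_close_to_thickness c0 h0 hc x_le uv v_bnd eta0 al1 qE q1 q8.
move: v_bnd => /andP[v0 _].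
rewrite (secular_identity b _ hc q1 qE) ?gt_eqF //= /secular_constant.
set K1 := mode_constant c in f_le *; set e := eta + v in f_le *.
have K10 : 0 <= K1 by rewrite addr_ge0 // !mulr_ge0 // ltW.
have e0 : 0 <= e by rewrite addr_ge0.
have ve : v <= e by rewrite lerDr.
have ee : eta <= e by rewrite lerDl.
have c2 : 0 <= c ^+ 2 by rewrite sqr_ge0.
have hn : \sum_i `|h i| = c ^+ 2.
  by rewrite -hc; apply: eq_bigr => i _; rewrite gtr0_norm.
set ub := \sum_j h j * u j; set t1 := \sum_j _ * u j.
set t2 := \sum_j q j * _; set t3 := \sum_j h j * (\sum_i (_ - _) * _).
set t4 := \sum_j h j * _.
have t1_le : `|2 * x * t1| <= 5 / 2 * c * K1 * e ^+ 2.
  have -> : 5 / 2 * c * K1 * e ^+ 2 = 2 * (5 / 4 * c) * (K1 * e * e) by field.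
  have x2_le : `|2 * x| <= 2 * (5 / 4 * c).
    by rewrite normrM normr_nat ler_wpM2l.
  rewrite normrM; apply: ler_pM => //.
  apply: le_trans (@norm_weighted_sum_le _ _ _ _ e _) _.
    by move=> j; apply: le_trans (uv j) ve.
  by rewrite ler_wpM2r.
have t2_le : `|c ^+ 2 * t2| <= 8 * c ^+ 2 * e ^+ 2.
  have -> : 8 * c ^+ 2 * e ^+ 2 = c ^+ 2 * (8 * e ^+ 2) by ring.
  rewrite normrM (ger0_norm c2); apply: ler_wpM2l => //.
  apply: le_trans (@norm_weighted_sum_le _ _ _ _ (e ^+ 2) _) _.
    by move=> i; rewrite normrX lerXn2r // ?nnegrE // (le_trans (uv i)).
  by rewrite ler_wpM2r // sqr_ge0.
have t3_le : `|t3| <= K1 * c ^+ 2 * e ^+ 2.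
  have -> : K1 * c ^+ 2 * e ^+ 2 = c ^+ 2 * (K1 * e * e) by ring.
  rewrite -hn; apply: norm_weighted_sum_le => j.
  apply: le_trans (@norm_weighted_sum_le _ _ _ _ e _) _.
    by move=> i; apply: le_trans (al1 _ _) ee.
  by rewrite ler_wpM2r.
have t4_le : `|t4| <= c ^+ 4 * e ^+ 2.
  have -> : c ^+ 4 * e ^+ 2 = c ^+ 2 * (c ^+ 2 * e ^+ 2) by ring.
  rewrite -{1}hn; apply: norm_weighted_sum_le => j; rewrite -hn.
  apply: norm_weighted_sum_le => i; apply: le_trans (bal _ _) _.
  by rewrite lerXn2r.
have ub_le : ub ^+ 2 / c ^+ 2 <= c ^+ 2 * e ^+ 2.
  rewrite ler_pdivrMr ?exprn_gt0 // -[ub ^+ 2]real_normK ?num_real //.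
  have -> : c ^+ 2 * e ^+ 2 * c ^+ 2 = (c ^+ 2 * e) ^+ 2 by ring.
  apply: lerXn2r; rewrite ?nnegrE ?mulr_ge0 // ?(ltW c0) //.
  rewrite -hn; apply: norm_weighted_sum_le => j.
  exact: le_trans (uv j) ve.
have ub0 : 0 <= ub ^+ 2 / c ^+ 2 by rewrite divr_ge0 ?sqr_ge0.
have tot := lerD (lerD (lerD t1_le t2_le) (lerD t4_le t3_le)) ub_le.
have -> : (5 / 2 * c * K1 + 9 * c ^+ 2 + K1 * c ^+ 2 + c ^+ 4) * e ^+ 2
    = 5 / 2 * c * K1 * e ^+ 2 + 8 * c ^+ 2 * e ^+ 2
      + (c ^+ 4 * e ^+ 2 + K1 * c ^+ 2 * e ^+ 2) + c ^+ 2 * e ^+ 2 by ring.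
apply: le_trans tot.
apply: le_trans (ler_normD _ _) _; rewrite (ger0_norm ub0) lerD2r.
apply: le_trans (ler_normD _ _) _.
by apply: lerD; apply: ler_normB.
Qed.

(** With y = x - ubar and k = B / (2 c^3), the estimate for c^2 y^2 - (c^4 - B)
bounds the product (y - sg (c - k)) (y + sg (c - k)); its second factor is at
least c in absolute value, because it is close to 2 sg c. *)
Lemma eigenmode_expansion (R : realFieldType) (n : nat)
    (h u q : 'I_n -> R) (al b : 'I_n -> 'I_n -> R) (c x eta v sg : R) :
  0 < c -> (forall i, 0 < h i) -> \sum_i h i = c ^+ 2 ->
  sg ^+ 2 = 1 -> `|x - sg * c| <= c / 4 ->
  (forall j, `|u j| <= v) -> 0 <= v <= c / 4 -> 0 <= eta <= 1 / 8 ->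
  (forall i j, `|1 - al i j| <= eta) -> (forall i j, `|b i j| <= eta) ->
  (forall i j, `|b i j - (1 - al i j)| <= eta ^+ 2) ->
  (forall j, \sum_i q i * al i j * h j = (x - u j) ^+ 2 * q j) ->
  (exists i, q i != 0) ->
  `|x - ((\sum_j h j * u j) / c ^+ 2
         + sg * (c - (2 * c ^+ 3)^-1 * \sum_i \sum_j h i * h j * b i j))|
   <= expansion_constant c * (eta + v) ^+ 2.
Proof.
move=> c0 h0 hc sg2 xc uv v_bnd /andP[eta0 eta8] al1 b1 bal qE [i0 qi0].
have nsg : `|sg| = 1.
  by apply/eqP; rewrite -sqrp_eq1 // -normrX sg2 normr1.
have nsc : `|sg * c| = c by rewrite normrM nsg mul1r gtr0_norm.
have x_ge : 3 / 4 * c <= `|x|.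
  by have := lerB_dist (sg * c) (sg * c - x); rewrite subKr distrC; lra.
have x_le : `|x| <= 5 / 4 * c.
  by have := ler_normD (x - sg * c) (sg * c); rewrite subrK; lra.
have [v0 vc] := andP v_bnd.
set S := \sum_i q i.
have mass := eigenvector_mass c0 h0 hc x_ge uv vc eta8 al1 qE.
have S0 : S != 0.
  apply: contraNneq qi0 => S0; move: mass; rewrite -/S S0 normr0 mulr0 => le0.
  have : `|q i0| <= 0.
    by apply: le_trans le0; rewrite (bigD1 i0) //= lerDl sumr_ge0.
  by rewrite normr_le0.
have qE' j : \sum_i q i / S * al i j * h j = (x - u j) ^+ 2 * (q j / S).
  rewrite mulrA -qE mulr_suml; apply: eq_bigr => i _; ring.
have q1 : \sum_i q i / S = 1 by rewrite -mulr_suml divff.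
have q8 : \sum_i `|q i / S| <= 8.
  under eq_bigr => i _ do rewrite normrM normfV.
  by rewrite -mulr_suml ler_pdivrMr ?normr_gt0.
have := normalised_secular_estimate c0 h0 hc x_le uv v_bnd eta0 al1 bal
  qE' q1 q8.
set ub := _ / c ^+ 2; set B := \sum_i \sum_j _; set K := secular_constant c.
set e := eta + v => est.
have hn : \sum_i `|h i| = c ^+ 2.
  by rewrite -hc; apply: eq_bigr => i _; rewrite gtr0_norm.
have c2 : 0 <= c ^+ 2 by rewrite sqr_ge0.
have B_le : `|B| <= c ^+ 4 * eta.
  have -> : B = \sum_i h i * (\sum_j h j * b i j).
    by apply: eq_bigr => i _; rewrite mulr_sumr; apply: eq_bigr => j _; ring.
  have -> : c ^+ 4 * eta = c ^+ 2 * (c ^+ 2 * eta) by ring.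
  rewrite -{1}hn; apply: norm_weighted_sum_le => i; rewrite -hn.
  exact: norm_weighted_sum_le.
have ub_le : `|ub| <= v.
  rewrite normrM normfV (ger0_norm c2) ler_pdivrMr ?exprn_gt0 // mulrC -hn.
  exact: norm_weighted_sum_le.
set k := (2 * c ^+ 3)^-1 * B.
have k_le : `|k| <= c / 2 * eta.
  rewrite /k normrM ger0_norm ?invr_ge0 ?mulr_ge0 ?exprn_ge0 ?(ltW c0) //.
  rewrite mulrC ler_pdivrMr ?mulr_gt0 ?exprn_gt0 //.
  by have -> : c / 2 * eta * (2 * c ^+ 3) = c ^+ 4 * eta by field.
have BE : B = 2 * c ^+ 3 * k by rewrite /k; field; rewrite gt_eqF.
set y := x - ub in est *.
have -> : x - (ub + sg * (c - k)) = y - sg * (c - k) by rewrite /y; ring.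
have far : c <= `|y + sg * (c - k)|.
  have -> : y + sg * (c - k) = 2 * (sg * c) - (ub + sg * k - (x - sg * c)).
    by rewrite /y; ring.
  apply: le_trans (lerB_dist _ _); rewrite [`|2 * _|]normrM nsc normr_nat.
  have := ler_normB (ub + sg * k) (x - sg * c); have := ler_normD ub (sg * k).
  have : c / 2 * eta <= c / 2 * (1 / 8) by rewrite ler_wpM2l //; lra.
  by rewrite [`|sg * k|]normrM nsg mul1r; lra.
have c3 : 0 < c ^+ 3 by rewrite exprn_gt0.
have facE : c ^+ 2 * ((y - sg * (c - k)) * (y + sg * (c - k)))
    = (c ^+ 2 * y ^+ 2 - (c ^+ 4 - B)) - c ^+ 2 * k ^+ 2.
  rewrite BE; transitivity (c ^+ 2 * (y ^+ 2 - sg ^+ 2 * (c - k) ^+ 2)).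
    by ring.
  by rewrite sg2; ring.
have k2 : c ^+ 2 * k ^+ 2 <= c ^+ 4 * e ^+ 2.
  have -> : c ^+ 4 * e ^+ 2 = c ^+ 2 * (c * e) ^+ 2 by ring.
  rewrite ler_wpM2l // -[k ^+ 2]real_normK ?num_real //.
  have ee : eta <= e by rewrite lerDl.
  have e0 : 0 <= e by rewrite addr_ge0.
  apply: lerXn2r; rewrite ?nnegrE ?(mulr_ge0 (ltW c0)) //.
  apply: le_trans k_le _; rewrite -mulrA ler_wpM2l ?(ltW c0) //; lra.
rewrite /expansion_constant mulrAC ler_pdivlMr //.
set d := y - sg * (c - k) in facE *.
have : c ^+ 2 * (`|d| * `|y + sg * (c - k)|) <= (K + c ^+ 4) * e ^+ 2.
  rewrite -normrM -{1}(ger0_norm c2) -normrM facE.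
  apply: le_trans (ler_normB _ _) _.
  have := mulr_ge0 c2 (sqr_ge0 k) => k20.
  by rewrite (ger0_norm k20) mulrDl lerD.
apply: le_trans; have -> : `|d| * c ^+ 3 = c ^+ 2 * (`|d| * c) by ring.
by rewrite ler_wpM2l // ler_wpM2l.
Qed.

(** * Distance to rest *)

Section Rest.
Variables (R : realType) (n : nat).
Implicit Types (U : 'cV[R]_(n + n + n)) (gamma : 'cV[R]_n.-1).

Definition density_defect gamma : R := \sum_j (1 - gamma j 0).

Definition speed U : R := \sum_k `|velocity_x U k 0|.

(** The first-order part of 1 - alpha_ik.  For i <= k the range is empty, in
agreement with alpha_ik = 1. *)
Definition interface_defect gamma (i k : 'I_n) : R :=
  \sum_(l < n.-1 | (k <= l < i)%N) (1 - gamma l 0).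

Lemma near_rest_le (h : 'cV[R]_n) (d d' : R) U gamma :
  d <= d' -> near_rest h d U gamma -> near_rest h d' U gamma.
Proof.
move=> dd' [hU uU gU]; split=> // [k|j]; first exact: lt_le_trans (uU k) dd'.
by have [g01 gd] := gU j; split=> //; apply: lt_le_trans dd'.
Qed.

Lemma near_rest_defects (h : 'cV[R]_n) (d : R) U gamma :
  near_rest h d U gamma ->
  0 <= density_defect gamma <= n%:R * d /\ 0 <= speed U <= n%:R * d.
Proof.
move=> [_ uU gU]; split; last first.
  have -> : n%:R * d = \sum_(k < n) d by rewrite sumr_const card_ord mulr_natl.
  by rewrite sumr_ge0 //=; apply: ler_sum => k _; apply: ltW.
have g0 j : 0 <= 1 - gamma j 0 by have [/andP[_]] := gU j; rewrite subr_ge0.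
rewrite sumr_ge0 //=; apply: (@le_trans _ _ (n.-1%:R * d)).
  have -> : n.-1%:R * d = \sum_(j < n.-1) d.
    by rewrite sumr_const card_ord mulr_natl.
  by apply: ler_sum => j _; rewrite ltW //; case: (gU j).
have [->|n0] := posnP n; first by rewrite mul0r.
have d0 : 0 <= d by apply: le_trans (ltW (uU (Ordinal n0))).
by rewrite ler_wpM2r // ler_nat leq_pred.
Qed.

(** Expanding the square, the cross term is exactly twice the mixed part of the
remainder, and the two squares are handled by Cauchy-Schwarz. *)
Lemma defects_sqr_le U gamma :
  (forall j, gamma j 0 <= 1) ->
  (density_defect gamma + speed U) ^+ 2
    <= (n%:R + 2) * remainder_scale U gamma.
Proof.
move=> g1; set t1 := \sum_j `|(1 - gamma j 0) ^+ 2|.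
pose t2 := \sum_j \sum_k `|(1 - gamma j 0) * velocity_x U k 0|.
pose t3 := \sum_k `|velocity_x U k 0 ^+ 2|.
have t10 : 0 <= t1 by apply: sumr_ge0.
have t20 : 0 <= t2 by apply: sumr_ge0 => j _; apply: sumr_ge0.
have t30 : 0 <= t3 by apply: sumr_ge0.
have -> : remainder_scale U gamma = t1 + t2 + t3 by [].
have n0 : 0 <= n%:R :> R by [].
have e1 : density_defect gamma ^+ 2 <= n%:R * t1.
  apply: le_trans (sqr_sum_le _) _; apply: ler_pM => //.
  - by apply: sumr_ge0 => j _; apply: sqr_ge0.
  - by rewrite ler_nat leq_pred.
  - by apply: ler_sum => j _; apply: ler_norm.
have e2 : density_defect gamma * speed U = t2.
  rewrite /density_defect mulr_suml; apply: eq_bigr => j _.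
  rewrite mulr_sumr; apply: eq_bigr => k _.
  by rewrite normrM ger0_norm // subr_ge0.
have e3 : speed U ^+ 2 <= n%:R * t3.
  apply: le_trans (sqr_sum_le _) _; apply: ler_wpM2l => //.
  by apply: ler_sum => j _; rewrite normrX.
have n2 := mulr_ge0 n0 t20.
rewrite sqrrD e2 -mulr_natl; lra.
Qed.

Lemma alpha_defect gamma (i k : 'I_n) :
  (forall j, 0 < gamma j 0 <= 1) ->
  [/\ `|1 - alpha gamma i k| <= density_defect gamma,
      `|interface_defect gamma i k| <= density_defect gamma &
      `|interface_defect gamma i k - (1 - alpha gamma i k)|
        <= density_defect gamma ^+ 2].
Proof.
move=> g01.
have -> : alpha gamma i k = \prod_(j < n.-1 | (k <= j < i)%N) gamma j 0.
  rewrite /alpha; case: ltnP => // ik; rewrite big_pred0 // => j.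
  by apply/negP => /andP[kj ji]; move: (leq_ltn_trans kj ji); rewrite ltnNge ik.
have [d0 ds sds] := prod_deficit (index_enum 'I_n.-1)
  (fun j => (k <= j < i)%N) (fun j => g01 j).
have g0 j : 0 <= 1 - gamma j 0 by have /andP[_] := g01 j; rewrite subr_ge0.
have s0 : 0 <= interface_defect gamma i k by apply: sumr_ge0.
have sd : interface_defect gamma i k <= density_defect gamma.
  rewrite /interface_defect big_mkcond; apply: ler_sum => j _.
  by case: ifP.
rewrite -/(interface_defect gamma i k) in ds sds.
split.
- by rewrite ger0_norm //; apply: le_trans sd.
- by rewrite ger0_norm.
- rewrite ger0_norm ?subr_ge0 //; apply: le_trans sds _.
  by rewrite lerXn2r // nnegrE // (le_trans s0).
Qed.

(** An interface l contributes to the pair (i, k) exactly when it separates the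
two layers, k above and i below, so summing over l last factors the double
sum. *)
Lemma sum_interface_defect (h : 'I_n -> R) gamma :
  \sum_i \sum_k h i * h k * interface_defect gamma i k
  = \sum_(l < n.-1) (1 - gamma l 0) * (\sum_(k < n | (k <= l)%N) h k)
                                    * (\sum_(k < n | (l < k)%N) h k).
Proof.
transitivity (\sum_(i < n) \sum_(k < n) \sum_(l < n.-1)
  (if (k <= l < i)%N then h i * h k * (1 - gamma l 0) else 0)).
  apply: eq_bigr => i _; apply: eq_bigr => k _.
  by rewrite mulr_sumr big_mkcond.
under eq_bigr => i _ do rewrite exchange_big.
rewrite exchange_big /=; apply: eq_bigr => l _.
rewrite mulr_sumr [RHS]big_mkcond; apply: eq_bigr => i _ /=.
case: (ltnP l i) => li; last by rewrite big1 // => k _; rewrite andbF.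
rewrite [in RHS]big_mkcond mulr_sumr mulr_suml; apply: eq_bigr => k _ /=.
by rewrite andbT; case: ifP => _; ring.
Qed.

Lemma powR_three_halves (H : R) : 0 <= H -> H `^ (3 / 2) = Num.sqrt H ^+ 3.
Proof.
move=> H0; have -> : 3 / 2 = 2^-1 * 3%:R :> R by rewrite mulrC.
by rewrite powRrM powR12_sqrt // powR_mulrn // sqrtr_ge0.
Qed.

End Rest.

(** * Barotropic eigenvalues *)

Section Branch.
Variables (R : realType) (n : nat) (h : 'cV[R]_n) (s : bool).
Hypotheses (n_gt0 : (0 < n)%N) (h_gt0 : forall i, 0 < h i 0).
Implicit Types (U : 'cV[R]_(n + n + n)) (gamma : 'cV[R]_n.-1).

Let c : R := Num.sqrt (total_height h).
Let sg : R := (-1) ^+ s.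

Lemma total_height_gt0 : 0 < total_height h.
Proof.
rewrite /total_height (bigD1 (Ordinal n_gt0)) //= ltr_pwDl //.
by apply: sumr_ge0 => i _; apply: ltW.
Qed.

Lemma celerity_gt0 : 0 < c. Proof. by rewrite sqrtr_gt0 total_height_gt0. Qed.

Lemma celerity_sqr : c ^+ 2 = total_height h.
Proof. by rewrite sqr_sqrtr // ltW // total_height_gt0. Qed.

Let sg2 : sg ^+ 2 = 1. Proof. by rewrite /sg sqrr_sign. Qed.
Let nsg : `|sg| = 1. Proof. by rewrite /sg normr_sign. Qed.

Lemma velocity_le_speed U k : `|velocity_x U k 0| <= speed U.
Proof. by rewrite /speed (bigD1 k) //= lerDl sumr_ge0. Qed.

Lemma near_rest_small (e : R) : 0 < e ->
  exists2 delta : R, 0 < delta &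
    forall U gamma, near_rest h delta U gamma ->
      density_defect gamma <= e /\ speed U <= e.
Proof.
move=> e0; have n0 : 0 < n%:R :> R by rewrite ltr0n.
exists (e / n%:R) => [|U gamma /near_rest_defects]; first exact: divr_gt0.
by rewrite mulrC divfK ?gt_eqF // => -[/andP[_ ->] /andP[_ ->]].
Qed.

(** This concerns every eigenvalue in the window of radius c / 4, not only the
values of a continuous branch. *)
Lemma eigenvalue_expansion :
  exists2 delta : R, 0 < delta &
  forall U gamma x, near_rest h delta U gamma -> eigenvalue (A_x U gamma) x ->
    `|x - sg * c| < c / 4 ->
    `|x - barotropic_expansion s U gamma|
      <= expansion_constant c * (density_defect gamma + speed U) ^+ 2.
Proof.
have c0 := celerity_gt0.
have [|d d0 dP] := @near_rest_small (Num.min (1 / 8) (c / 4)).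
  by rewrite lt_min; apply/andP; split; lra.
exists d => // U gamma x nr ev xc; have [] := dP _ _ nr.
rewrite !le_min => /andP[eta8 _] /andP[_ vc].
have [/andP[eta0 _] /andP[v0 _]] := near_rest_defects nr.
have [hU _ gU] := nr.
have g01 j : 0 < gamma j 0 <= 1 by case: (gU j).
have xu j : x - velocity_x U j 0 != 0.
  rewrite -normr_gt0; have := lerB_dist x (velocity_x U j 0).
  have := lerB_dist (sg * c) (sg * c - x); rewrite subKr.
  rewrite [`|sg * c - x|]distrC [`|sg * c|]normrM.
  by have := velocity_le_speed U j; rewrite nsg mul1r (gtr0_norm c0); lra.
have [q q0 qE] := (eigenvalue_A_xP gamma xu).1 ev.
have q_ex : exists i, q 0 i != 0.
  apply/existsP; apply: contraNT q0 => /existsPn q0; apply/eqP/rowP => i.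
  by rewrite mxE; apply/eqP; rewrite -[_ == _]negbK q0.
have hc : \sum_i h i 0 = c ^+ 2 by rewrite celerity_sqr.
rewrite hU in qE.
have := eigenmode_expansion (b := interface_defect gamma) c0 h_gt0 hc sg2
  (ltW xc) (velocity_le_speed U) _ _ _ _ _ qE q_ex.
move=> /(_ (density_defect gamma)); rewrite sum_interface_defect.
rewrite /barotropic_expansion /mean_velocity_x hU -celerity_sqr.
rewrite powR_three_halves ?sqr_ge0 // sqrtr_sqr (gtr0_norm c0).
apply; rewrite ?v0 ?eta0 //.
- by move=> i j; case: (alpha_defect i j g01).
- by move=> i j; case: (alpha_defect i j g01).
- by move=> i j; case: (alpha_defect i j g01).
Qed.

(** * Existence of an eigenvalue near +-sqrt H *)

(** A row q in the left kernel is a solution of the equations of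
[eigenvalue_A_xP].  Clearing the denominators h_j keeps the entries polynomial
in x. *)
Definition secular_mx U gamma (x : R) : 'M[R]_n :=
  \matrix_(i, j) ((x - velocity_x U j 0) ^+ 2 *+ (i == j)
                  - alpha gamma i j * h j 0).

(** The value of [secular_mx] at rest.  It depends on x through x^2 only, so one
positive argument y serves both signs x = y and x = - y. *)
Definition rest_secular_mx (y : R) : 'M[R]_n :=
  (y ^+ 2)%:M - const_mx 1 *m h^T.

Lemma rest_secular_mxE y i j :
  rest_secular_mx y i j = y ^+ 2 *+ (i == j) - h j 0.
Proof. by rewrite !mxE big_ord1 !mxE mul1r. Qed.

Lemma det_rest_secular_mx (y : R) : y != 0 ->
  \det (rest_secular_mx y) = (y ^+ 2) ^+ n * (1 - c ^+ 2 / y ^+ 2).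
Proof.
move=> y0; rewrite det_scalar_sub_rank1 ?expf_neq0 // celerity_sqr !mxE.
by congr (_ * (1 - _ / _)); apply: eq_bigr => i _; rewrite !mxE mulr1.
Qed.

Lemma secular_mx_near (y : R) (D : R) : 0 < D -> 0 <= y <= 2 * c ->
  exists2 delta : R, 0 < delta &
  forall U gamma, near_rest h delta U gamma ->
    `|\det (secular_mx U gamma (sg * y)) - \det (rest_secular_mx y)| < D.
Proof.
move=> D0 /andP[y0 yc]; have c0 := celerity_gt0.
(* d bounds the entrywise perturbation; it is at most 1 and d Q < D. *)
set Q := \sum_(t : 'S_n) \prod_i (1 + `|rest_secular_mx y i (t i)|).
have Q0 : 0 <= Q.
  by apply: sumr_ge0 => t _; apply: prodr_ge0 => i _; rewrite addr_ge0.
pose d := Num.min 1 (D / (Q + 1)).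
have d0 : 0 < d by rewrite lt_min ltr01 divr_gt0 // ltr_wpDl.
have dQ : d * Q < D.
  have : d * (Q + 1) <= D.
    by rewrite -ler_pdivlMr ?ltr_wpDl // ge_min lexx orbT.
  by apply: lt_le_trans; rewrite ltr_pM2l // ltrDl.
pose L := 5 * c + c ^+ 2.
have L0 : 0 < L by rewrite addr_gt0 ?exprn_gt0 ?mulr_gt0.
have [|delta delta0 near] := @near_rest_small (Num.min c (d / L)).
  by rewrite lt_min c0 divr_gt0.
exists delta => // U gamma nr; apply: le_lt_trans dQ.
have [hU _ gU] := nr; have := near _ _ nr; rewrite !le_min.
move=> [/andP[_ eta_le] /andP[vc v_le]].
have g01 j : 0 < gamma j 0 <= 1 by case: (gU j).
apply: det_sub_le; first by rewrite (ltW d0) /= ge_min lexx.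
move=> i j; rewrite rest_secular_mxE mxE.
set u := velocity_x U j 0; set al := alpha gamma i j.
have uv : `|u| <= d / L by apply: le_trans v_le; apply: velocity_le_speed.
have uc : `|u| <= c by apply: le_trans vc; apply: velocity_le_speed.
have alP : `|1 - al| <= d / L.
  by apply: le_trans eta_le; have [] := alpha_defect i j g01.
have hj : `|h j 0| <= c ^+ 2.
  rewrite gtr0_norm // celerity_sqr /total_height (bigD1 j) //= lerDl.
  by apply: sumr_ge0 => k _; apply: ltW.
have -> : (sg * y - u) ^+ 2 *+ (i == j) - al * h j 0
    - (y ^+ 2 *+ (i == j) - h j 0)
    = (u * (u - 2 * (sg * y))) *+ (i == j) + (1 - al) * h j 0.
  case: (i == j); rewrite ?mulr1n ?mulr0n; last by ring.
  transitivity (sg ^+ 2 * y ^+ 2 - y ^+ 2 + u * (u - 2 * (sg * y))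
    + (1 - al) * h j 0); first by ring.
  by rewrite sg2; ring.
have dL : d = 5 * c * (d / L) + c ^+ 2 * (d / L).
  by rewrite -mulrDl mulrC divfK // gt_eqF.
apply: le_trans (ler_normD _ _) _; rewrite [leRHS]dL; apply: lerD; last first.
  by rewrite normrM mulrC ler_pM.
case: (i == j); rewrite ?mulr1n ?mulr0n; last first.
  by rewrite normr0 !mulr_ge0 ?invr_ge0 // ltW.
rewrite normrM mulrC ler_pM //; apply: le_trans (ler_normB _ _) _.
by rewrite !normrM normr_nat nsg mul1r (ger0_norm y0); lra.
Qed.

(** The determinant is taken as a polynomial in y with x = sg y, so that the
intermediate value theorem is applied on [7c/8, 9c/8] for both signs. *)
Lemma secular_root : exists2 delta : R, 0 < delta &
  forall U gamma, near_rest h delta U gamma ->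
    exists2 x, \det (secular_mx U gamma x) = 0 & `|x - sg * c| <= c / 8.
Proof.
have c0 := celerity_gt0; pose y1 := 7 / 8 * c; pose y2 := 9 / 8 * c.
have y10 : 0 < y1 by rewrite /y1; lra.
have y20 : 0 < y2 by rewrite /y2; lra.
have det1 : \det (rest_secular_mx y1) < 0.
  rewrite det_rest_secular_mx ?gt_eqF // pmulr_rlt0 ?exprn_gt0 //.
  by rewrite subr_lt0 ltr_pdivlMr ?exprn_gt0 // /y1; nra.
have det2 : 0 < \det (rest_secular_mx y2).
  rewrite det_rest_secular_mx ?gt_eqF // pmulr_rgt0 ?exprn_gt0 //.
  by rewrite subr_gt0 ltr_pdivrMr ?exprn_gt0 // /y2; nra.
have [||d1 d10 near1] := @secular_mx_near y1 (- \det (rest_secular_mx y1)).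
- by rewrite oppr_gt0.
- by rewrite ltW //= /y1; lra.
have [||d2 d20 near2] := @secular_mx_near y2 (\det (rest_secular_mx y2)) => //.
  by rewrite ltW //= /y2; lra.
exists (Num.min d1 d2) => [|U gamma nr]; first by rewrite lt_min d10.
have /near1 : near_rest h d1 U gamma.
  by apply: near_rest_le nr; rewrite ge_min lexx.
have /near2 : near_rest h d2 U gamma.
  by apply: near_rest_le nr; rewrite ge_min lexx orbT.
rewrite !ltr_norml => /andP[lt2 _] /andP[_ lt1].
pose P : 'M[{poly R}]_n := \matrix_(i, j)
  ((sg%:P * 'X - (velocity_x U j 0)%:P) ^+ 2 *+ (i == j)
   - (alpha gamma i j * h j 0)%:P).
have PE y : (\det P).[y] = \det (secular_mx U gamma (sg * y)).
  rewrite -horner_evalE -det_map_mx; congr (\det _); apply/matrixP => i j.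
  rewrite 2!mxE [RHS]mxE /= /horner_eval.
  by case: (i == j); rewrite ?mulr1n ?mulr0n !hornerE.
have [||z z12 /rootP Pz] := @poly_ivt R (\det P) y1 y2.
- by rewrite /y1 /y2; lra.
- by rewrite !PE; apply/andP; split; lra.
exists (sg * z); first by rewrite -PE.
rewrite -mulrBr normrM nsg mul1r ler_norml; move/andP: z12 => [].
by rewrite /y1 /y2 => *; apply/andP; split; lra.
Qed.

(** The root lies within c / 8 of sg c, hence away from the velocities, and the
equations can be turned back into an eigenvector. *)
Lemma barotropic_root : exists2 delta : R, 0 < delta &
  forall U gamma, near_rest h delta U gamma ->
    exists x, eigenvalue (A_x U gamma) x /\ `|x - sg * c| < c / 4.
Proof.
have c0 := celerity_gt0; have c4 : 0 < c / 4 by rewrite divr_gt0.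
have [d1 d10 root1] := secular_root; have [d2 d20 small] := near_rest_small c4.
exists (Num.min d1 d2) => [|U gamma nr]; first by rewrite lt_min d10.
have [|x detx xc] := root1 U gamma.
  by apply: near_rest_le nr; rewrite ge_min lexx.
have [|_ vc] := small U gamma.
  by apply: near_rest_le nr; rewrite ge_min lexx orbT.
exists x; split; last by lra.
have xu j : x - velocity_x U j 0 != 0.
  rewrite -normr_gt0; have := lerB_dist x (velocity_x U j 0).
  have := lerB_dist (sg * c) (sg * c - x); rewrite subKr.
  rewrite [`|sg * c - x|]distrC [`|sg * c|]normrM.
  by have := velocity_le_speed U j; rewrite nsg mul1r (gtr0_norm c0); lra.
move/eqP/det0P: detx => [q q0 qM]; apply/(eigenvalue_A_xP gamma xu).
exists q => // j; case: nr => -> _ _.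
transitivity (\sum_i q 0 i * ((x - velocity_x U j 0) ^+ 2 *+ (i == j))).
  apply/esym/eqP; rewrite -subr_eq0 -sumrB; apply/eqP.
  transitivity ((q *m secular_mx U gamma x) 0 j); last by rewrite qM mxE.
  rewrite [RHS]mxE; apply: eq_bigr => i _.
  by rewrite [secular_mx _ _ _ _ _]mxE mulrBr mulrA.
rewrite (bigD1 j) //= eqxx big1 => [|i /negPf ->]; last first.
  by rewrite mulr0n mulr0.
by rewrite addr0 mulr1n mulrC.
Qed.

Lemma expansion_near_rest U gamma :
  thickness U = h -> (forall j, gamma j 0 <= 1) ->
  `|barotropic_expansion s U gamma - sg * c|
    <= (1 + c) * (density_defect gamma + speed U).
Proof.
move=> hU g1; have c0 := celerity_gt0.
rewrite /barotropic_expansion /mean_velocity_x hU -celerity_sqr.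
rewrite powR_three_halves ?sqr_ge0 // sqrtr_sqr (gtr0_norm c0).
set ub := _ / c ^+ 2; set B := \sum_j _; set eta := density_defect gamma.
have part0 (p : pred 'I_n) : 0 <= \sum_(k | p k) h k 0.
  by apply: sumr_ge0 => k _; apply: ltW.
have part_le (p : pred 'I_n) : \sum_(k | p k) h k 0 <= c ^+ 2.
  rewrite celerity_sqr /total_height big_mkcond; apply: ler_sum => k _.
  by case: ifP => // _; apply: ltW.
have g0 j : 0 <= 1 - gamma j 0 by rewrite subr_ge0.
have B0 : 0 <= B by apply: sumr_ge0 => j _; rewrite !mulr_ge0.
have B_le : B <= eta * (c ^+ 2 * c ^+ 2).
  rewrite /eta mulr_suml; apply: ler_sum => j _; rewrite -mulrA.
  by rewrite ler_wpM2l // ler_pM.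
have eta0 : 0 <= eta by apply: sumr_ge0.
have v0 : 0 <= speed U by apply: sumr_ge0.
have ub_le : `|ub| <= speed U.
  rewrite normrM normfV (gtr0_norm (exprn_gt0 2 c0)) ler_pdivrMr ?exprn_gt0 //.
  rewrite mulrC celerity_sqr.
  have -> : total_height h = \sum_i `|h i 0|.
    by apply: eq_bigr => i _; rewrite gtr0_norm.
  by apply: norm_weighted_sum_le => i; apply: velocity_le_speed.
have k_le : (2 * c ^+ 3)^-1 * B <= c * eta.
  rewrite mulrC ler_pdivrMr ?mulr_gt0 ?exprn_gt0 //.
  apply: le_trans B_le _.
  have -> : c * eta * (2 * c ^+ 3) = 2 * (eta * (c ^+ 2 * c ^+ 2)) by ring.
  by rewrite ler_peMl ?ler1n // !mulr_ge0 // ltW.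
have -> : ub + sg * (c - (2 * c ^+ 3)^-1 * B) - sg * c
    = ub - sg * ((2 * c ^+ 3)^-1 * B) by ring.
apply: le_trans (ler_normB _ _) _; rewrite [`|sg * _|]normrM nsg mul1r.
rewrite [`|_ * B|]ger0_norm; last first.
  by rewrite mulr_ge0 // invr_ge0 mulr_ge0 // exprn_ge0 // ltW.
by have := mulr_ge0 (ltW c0) v0; lra.
Qed.

(** Any choice of an eigenvalue in the window is a branch:
[eigenvalue_expansion] and [expansion_near_rest] bound its distance to sg c by a multiple of the
distance to rest, which gives both the value at rest and the continuity. *)
Lemma barotropic_eigenvalue_exists : exists lam, barotropic_eigenvalue h s lam.
Proof.
have c0 := celerity_gt0.
have [d1 d10 root1] := barotropic_root.
have [d2 d20 expand] := eigenvalue_expansion.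
set K := expansion_constant c in expand.
have K0 : 0 <= K by rewrite expansion_constant_ge0 // ltW.
pose d := Num.min d1 d2.
have d0 : 0 < d by rewrite lt_min d10.
have branch (p : 'cV[R]_(n + n + n) * 'cV[R]_n.-1) : exists x,
    near_rest h d p.1 p.2 ->
    eigenvalue (A_x p.1 p.2) x /\ `|x - sg * c| < c / 4.
  (* The value 0 is a placeholder for configurations far from rest. *)
  have [nr|] := pselect (near_rest h d p.1 p.2); last by exists 0.
  have [|x xP] := root1 p.1 p.2; last by exists x.
  by apply: near_rest_le nr; rewrite ge_min lexx.
have [f fP] := choice branch; pose lam U gamma := f (U, gamma).
have lam_le U gamma : near_rest h d U gamma ->
    `|lam U gamma - sg * c| <= K * (density_defect gamma + speed U) ^+ 2
      + (1 + c) * (density_defect gamma + speed U).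
  move=> nr; have [ev xc] := fP (U, gamma) nr; have [hU _ gU] := nr.
  apply: le_trans (ler_distD (barotropic_expansion s U gamma) _ _) _.
  apply: lerD; last first.
    by apply: expansion_near_rest => // j; case: (gU j) => /andP[].
  by apply: expand => //; apply: near_rest_le nr; rewrite ge_min lexx orbT.
exists lam; split.
- by exists d => // U gamma nr; case: (fP (U, gamma) nr).
- move=> U hU u0.
  have e0 : density_defect (const_mx 1 : 'cV[R]_n.-1) + speed U = 0.
    rewrite /density_defect /speed u0 !big1 ?addr0 // => i _.
      by rewrite mxE normr0.
    by rewrite mxE subrr.
  have := lam_le U (const_mx 1); rewrite e0 expr2 !mulr0 addr0 normr_le0.
  rewrite subr_eq0 => le0; apply/eqP/le0; split => // [k|j].
    by rewrite u0 mxE normr0.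
  by rewrite mxE subrr ltr01 lexx.
(* The bound K a^2 + (1 + c) a is at most (M / 2) a as soon as a <= 1. *)
- move=> e e0; pose M := 2 * K + 2 * (1 + c).
  have M0 : 0 < M by rewrite /M; lra.
  have [|d3 d30 small] := @near_rest_small (Num.min (1 / 2) (e / 2 / M)).
    by rewrite lt_min !divr_gt0.
  exists (Num.min d d3) => [|U gamma nr]; first by rewrite lt_min d0.
  have nr1 : near_rest h d U gamma.
    by apply: near_rest_le nr; rewrite ge_min lexx.
  have nr3 : near_rest h d3 U gamma.
    by apply: near_rest_le nr; rewrite ge_min lexx orbT.
  apply: le_lt_trans (lam_le _ _ nr1) _.
  have [/andP[eta0 _] /andP[v0 _]] := near_rest_defects nr1.
  have [] := small _ _ nr3; rewrite !le_min => /andP[eta2 etaM] /andP[v2 vM].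
  set a := density_defect gamma + speed U.
  have a_le : a <= 2 * (e / 2 / M) by rewrite /a; lra.
  have Ka : K * a ^+ 2 <= K * a.
    by rewrite ler_wpM2l // expr2 ler_piMl /a; lra.
  have : (K + (1 + c)) * a <= (K + (1 + c)) * (2 * (e / 2 / M)).
    by rewrite ler_wpM2l // !addr_ge0 // ltW.
  have -> : (K + (1 + c)) * (2 * (e / 2 / M)) = e / 2.
    have -> : K + (1 + c) = M / 2 by rewrite /M; field.
    by field; rewrite gt_eqF.
  by rewrite mulrDl; lra.
Qed.

End Branch.

Theorem proposition4p1 (R : realType) (n : nat) (n_gt0 : (0 < n)%N)
    (h : 'cV[R]_n) (h_gt0 : forall i, 0 < h i 0) (s : bool) :
  (exists lam, barotropic_eigenvalue h s lam) /\
  (forall lam, barotropic_eigenvalue h s lam ->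
    exists2 C : R, 0 <= C &
    exists2 delta : R, 0 < delta &
    forall (U : 'cV[R]_(n + n + n)) (gamma : 'cV[R]_n.-1),
      thickness U = h ->
      (forall j, 0 < gamma j 0 < 1) ->
      (forall j, 1 - gamma j 0 < delta) ->
      (forall k, `|velocity_x U k 0| < delta) ->
      `|lam U gamma - barotropic_expansion s U gamma|
        <= C * remainder_scale U gamma).
Proof.
split; first exact: barotropic_eigenvalue_exists.
move=> lam [[d1 d10 lam_eig] _ lam_cont].
have c0 : 0 < Num.sqrt (total_height h) by apply: celerity_gt0.
have [|d2 d20 lam_near] := lam_cont (Num.sqrt (total_height h) / 4).
  by rewrite divr_gt0.
have [d3 d30 expand] := eigenvalue_expansion s n_gt0 h_gt0.
set K := expansion_constant _ in expand.
have K0 : 0 <= K by rewrite expansion_constant_ge0 // ltW.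
exists (K * (n%:R + 2)); first by rewrite mulr_ge0 // addr_ge0.
exists (Num.min d1 (Num.min d2 d3)); first by rewrite !lt_min d10 d20.
move=> U gamma hU g01 g_near u_near.
have g01' j : 0 < gamma j 0 <= 1 by have /andP[-> /ltW] := g01 j.
have nr : near_rest h (Num.min d1 (Num.min d2 d3)) U gamma by split.
have nr_at d : Num.min d1 (Num.min d2 d3) <= d -> near_rest h d U gamma.
  by move=> dle; apply: near_rest_le nr.
apply: (@le_trans _ _ (K * (density_defect gamma + speed U) ^+ 2)).
  apply: expand.
  - by apply: nr_at; rewrite !ge_min lexx !orbT.
  - by apply: lam_eig; apply: nr_at; rewrite !ge_min lexx.
  - by apply: lam_near; apply: nr_at; rewrite !ge_min lexx !orbT.
rewrite -[leRHS]mulrA; apply: ler_wpM2l => //; apply: defects_sqr_le => j.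
by have /andP[] := g01' j.
Qed.
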